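(* Let $V$ be a real vector space with dual space $V^\vee$. Let $\alpha,\beta\in V$ and $\alpha^\vee,\beta^\vee\in V^\vee$ be such that $\alpha^\vee(\alpha)=\beta^\vee(\beta)=2$, $\alpha^\vee(\beta)<0$, $\beta^\vee(\alpha)<0$, and $\alpha^\vee(\beta)\,\beta^\vee(\alpha)=4\cos^2\frac{\pi}{n}$, where $n\ge 2$ is some integer. Then the Pitman transforms satisfy $$\mathcal P_\alpha\mathcal P_\beta\mathcal P_\alpha\cdots=\mathcal P_\beta\mathcal P_\alpha\mathcal P_\beta\cdots,$$ where there are $n$ factors in each product.
   Context: For $\alpha\in V$, $\alpha^\vee\in V^\vee$ with $\alpha^\vee(\alpha)=2$, the Pitman transform $\mathcal P_\alpha$ (depending on the pair $(\alpha,\alpha^\vee)$) acts on continuous paths $\pi:[0,T]\to V$ with $\pi(0)=0$ by $$\mathcal P_\alpha\pi(t)=\pi(t)-\inf_{0\le s\le t}\alpha^\vee(\pi(s))\,\alpha,\qquad 0\le t\le T.$$ $\mathcal P_\beta$ is defined similarly from $(\beta,\beta^\vee)$. Products denote composition of maps. *)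

(* Defs.v *)
From HB Require Import structures.
From mathcomp Require Import all_boot all_order all_algebra.
From mathcomp Require Import all_classical all_reals all_analysis.

Set Implicit Arguments.
Unset Strict Implicit.
Unset Printing Implicit Defensive.
Import Order.TTheory GRing.Theory Num.Theory.
Import numFieldNormedType.Exports.
Local Open Scope classical_set_scope.
Local Open Scope ring_scope.

(* A path on [0, T] is represented by a function on R, of which only the
   restriction to `[0, T] is relevant. *)
Definition is_path (R : realType) (V : topologicalLmodType R) (T : R)
    (p : R -> V) : Prop :=
  {within `[0, T], continuous p} /\ p 0 = 0.

(* When p is a path on [0, T], the form av is continuous and 0 <= t <= T, the
   set below is nonempty and bounded, so that [inf] is its genuine infimum;
   the values of [pitman a av p] on [0, T] depend only on those of p there. *)
Definition pitman (R : realType) (V : topologicalLmodType R)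
    (a : V) (av : {scalar V}) (p : R -> V) : R -> V :=
  fun t => p t - inf [set av (p s) | s in `[0, t]] *: a.

(* f \o g \o f \o ..., with n factors, the leftmost one being f *)
Fixpoint alt_comp (X : Type) (n : nat) (f g : X -> X) : X -> X :=
  if n is m.+1 then f \o alt_comp m g f else id.

(* Main.v *)
Require Import Defs.
From HB Require Import structures.
From mathcomp Require Import all_boot all_order all_algebra.
From mathcomp Require Import all_classical all_reals all_analysis.
From mathcomp Require Import ring lra.

(* After rescaling one root, av b = bv a = - 2 cos th with th = pi / n.  Put
   x = av \o p, y = bv \o p and U_i = sin ((i + 1) th) / sin th >= 0.  By
   induction on k <= n, adding the innermost factor,
     (P_a P_b P_a ...) p t = p t
       - inf (U_0 x(s_0) + U_1 y(s_1) + ... + U_(k-1) z(s_(k-1))) a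
       - inf (U_0 y(s_0) + U_1 x(s_1) + ... + U_(k-2) z'(s_(k-2))) b,
   the infima being over t >= s_0 >= s_1 >= ... >= 0.  The inductive step
   substitutes x - 2 I and y + 2 cos th I for x and y, where I is the running
   infimum of x.  In such an infimum, for fixed r <= t, the minimum of x - 2 I
   over [r, t] is the minimum of x minus I(r) + I(t), so each I moves to the
   neighbouring times, where it cancels by the recurrence
   U_(i+2) = 2 cos th U_(i+1) - U_i.  For k = n, the last coefficient U_(n-1)
   vanishes and the formula becomes symmetric in a and b. *)

Set Implicit Arguments.
Unset Strict Implicit.
Unset Printing Implicit Defensive.
Import Order.TTheory GRing.Theory Num.Theory.
Import numFieldNormedType.Exports.
Local Open Scope classical_set_scope.
Local Open Scope ring_scope.

(** * Running infima of continuous functions *)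

Definition runinf (R : realType) (f : R -> R) (t : R) : R :=
  inf [set f s | s in `[0, t]].

Lemma within_continuousZD (R : realType) (T c : R) (f g : R -> R) :
  {within `[0, T], continuous f} -> {within `[0, T], continuous g} ->
  {within `[0, T], continuous (fun s => c * f s + g s)}.
Proof.
move=> fc gc x; apply: cvgD; last exact: gc.
by apply: cvgM; [exact: cvg_cst | exact: fc].
Qed.

Lemma within_continuousDZ (R : realType) (T c : R) (f g : R -> R) :
  {within `[0, T], continuous f} -> {within `[0, T], continuous g} ->
  {within `[0, T], continuous (fun s => f s + c * g s)}.
Proof.
move=> fc gc x; apply: cvgD; first exact: fc.
by apply: cvgM; [exact: cvg_cst | exact: gc].
Qed.

Lemma within_continuousBZ (R : realType) (T c : R) (f g : R -> R) :
  {within `[0, T], continuous f} -> {within `[0, T], continuous g} ->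
  {within `[0, T], continuous (fun s => f s - c * g s)}.
Proof.
move=> fc gc x; apply: cvgB; first exact: fc.
by apply: cvgM; [exact: cvg_cst | exact: gc].
Qed.

Lemma runinf_min (R : realType) (T : R) (f : R -> R) (t : R) :
  {within `[0, T], continuous f} -> 0 <= t <= T ->
  exists2 u, 0 <= u <= t &
    runinf f t = f u /\ forall s, 0 <= s <= t -> f u <= f s.
Proof.
move=> fc /andP[t0 tT].
have /(EVT_min t0)[u] : {within `[0, t], continuous f}.
  by apply: continuous_subspaceW fc; apply: subset_itvl; rewrite bnd_simp.
rewrite in_itv /= => ut fu; exists u => //; split; last first.
  by move=> s st; apply: fu; rewrite in_itv.
have lbu : lbound [set f s | s in `[0, t]] (f u) by move=> _ [s /fu ? <-].
apply/eqP; rewrite eq_le; apply/andP; split.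
  by apply: ge_inf; [exists (f u) | exists u => //=; rewrite in_itv].
by apply: lb_le_inf => //; exists (f u), u => //=; rewrite in_itv.
Qed.

(** The universal property by which nested infima are compared one level at a time. *)
Lemma le_runinf (R : realType) (T : R) (f : R -> R) (t c : R) :
  {within `[0, T], continuous f} -> 0 <= t <= T ->
  c <= runinf f t <-> forall s, 0 <= s <= t -> c <= f s.
Proof.
move=> fc tT; have [u ut [-> fu]] := runinf_min fc tT.
by split=> [cu s /fu|]; [apply: le_trans | apply].
Qed.

Lemma runinf_le (R : realType) (T : R) (f : R -> R) (s t : R) :
  {within `[0, T], continuous f} -> 0 <= s <= t -> t <= T ->
  runinf f t <= f s.
Proof.
move=> fc st tT; have tT' : 0 <= t <= T by lra.
by move/(le_runinf _ fc tT') : (lexx (runinf f t)); apply.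
Qed.

Lemma runinf_anti (R : realType) (T : R) (f : R -> R) (s t : R) :
  {within `[0, T], continuous f} -> 0 <= s <= t -> t <= T ->
  runinf f t <= runinf f s.
Proof.
move=> fc st tT; have sT : 0 <= s <= T by lra.
by apply/(le_runinf _ fc sT) => r rs; apply: (runinf_le fc) => //; lra.
Qed.

Lemma eq_runinf (R : realType) (f g : R -> R) (t : R) :
  (forall s, 0 <= s <= t -> f s = g s) -> runinf f t = runinf g t.
Proof.
move=> fg; congr inf; apply/eq_imagel => s /=.
by rewrite in_itv; apply: fg.
Qed.

Lemma runinf_scale (R : realType) (T : R) (c : R) (f : R -> R) (t : R) :
  {within `[0, T], continuous f} -> 0 <= c -> 0 <= t <= T ->
  runinf (fun s => c * f s) t = c * runinf f t.
Proof.
move=> fc c0 tT; have [u ut [-> fu]] := runinf_min fc tT.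
have cfc : {within `[0, T], continuous (fun s => c * f s)}.
  by move=> x; apply: cvgM; [exact: cvg_cst | exact: fc].
apply/eqP; rewrite eq_le (runinf_le cfc ut) /=; last by case/andP: tT.
by apply/(le_runinf _ cfc tT) => s /fu; exact: ler_wpM2l.
Qed.

Lemma within_continuous_itvP (R : realType) (T : R) (f : R -> R) :
  {within `[0, T], continuous f} <->
  forall t, 0 <= t <= T -> forall e, 0 < e -> exists2 d, 0 < d &
    forall s, 0 <= s <= T -> `|t - s| < d -> `|f t - f s| < e.
Proof.
split=> [/subspace_continuousP fc t tT e e0|fc].
  have /fc /cvgrPdist_lt /(_ e e0) : [set` `[0, T]] t by rewrite /= in_itv.
  rewrite near_withinE => /nbhs_ballP[d /= d0 dP]; exists d => // s sT sd.
  by apply: dP => //=; rewrite in_itv.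
apply/subspace_continuousP => t /=; rewrite in_itv /= => tT.
apply/cvgrPdist_lt => e e0; rewrite near_withinE.
have [d d0 dP] := fc t tT e e0.
apply/nbhs_ballP; exists d => //= s sd /=; rewrite in_itv /= => sT.
exact: dP.
Qed.

(** A minimum point over [0, v] lies either in [0, u], and nothing drops between u and v, or in
    [u, v], and the drop is at most the fall of [f] from its value at u; this is [drop]. *)
Lemma runinf_continuous (R : realType) (T : R) (f : R -> R) :
  {within `[0, T], continuous f} -> {within `[0, T], continuous (runinf f)}.
Proof.
move=> fc; apply/within_continuous_itvP => t tT e e0.
(* Half of [e]: for s < t the drop is measured from s, and [f s] and [f r] are each compared with
   [f t]. *)
have [d d0 dP] := (within_continuous_itvP T f).1 fc t tT (e / 2) ltac:(lra).
exists d => // s sT std.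
have drop u v : 0 <= u -> u <= v -> v <= T ->
    (forall r, u <= r <= v -> f u < f r + e) ->
    runinf f v <= runinf f u < runinf f v + e.
  move=> u0 uv vT H; have vT' : 0 <= v <= T by lra.
  rewrite (runinf_anti fc) /=; [|lra|lra].
  have [r rv [-> _]] := runinf_min fc vT'.
  have [ru|/ltW ur] := leP r u.
    have := @runinf_le _ T f r u fc ltac:(lra) ltac:(lra); lra.
  have := H r ltac:(lra).
  have := @runinf_le _ T f u u fc ltac:(lra) ltac:(lra); lra.
have close r : 0 <= r <= T -> `|t - r| <= `|t - s| ->
    f t - e / 2 < f r < f t + e / 2.
  move=> rT rs; have := dP r rT (le_lt_trans rs std).
  by rewrite ltr_norml; lra.
have [ts|/ltW st] := leP t s.
  have := @drop t s ltac:(lra) ts ltac:(lra).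
  have /[swap]/[apply] : forall r, t <= r <= s -> f t < f r + e.
    move=> r rts; have := close r ltac:(lra).
    rewrite !ler0_norm; [|lra|lra]; move=> /(_ ltac:(lra)); lra.
  by rewrite ltr_norml; lra.
have := @drop s t ltac:(lra) st ltac:(lra).
have /[swap]/[apply] : forall r, s <= r <= t -> f s < f r + e.
  move=> r rst; have := close r ltac:(lra); have := close s sT (lexx _).
  rewrite !ger0_norm; [|lra|lra]; move=> ? /(_ ltac:(lra)); lra.
by rewrite ltr_norml; lra.
Qed.

(** Both sides are infima over pairs r <= s <= t. For fixed r, [key] and [key'] compare the two
    infima over s in [r, t], one in each direction, [key'] up to an error. *)
Lemma runinf_exchange (R : realType) (T c : R) (x h : R -> R) (t : R) :
  {within `[0, T], continuous x} -> {within `[0, T], continuous h} ->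
  0 <= c -> 0 <= t <= T ->
  runinf (fun s => c * (x s - 2 * runinf x s) +
                   runinf (fun r => c * runinf x r + h r) s) t =
  - c * runinf x t + runinf (fun s => c * x s + runinf h s) t.
Proof.
move=> xc hc c0 tT.
have Ic := runinf_continuous xc.
have hIc : {within `[0, T], continuous (fun r => c * runinf x r + h r)}.
  exact: within_continuousZD.
have lc : {within `[0, T], continuous (fun s => c * (x s - 2 * runinf x s) +
    runinf (fun r => c * runinf x r + h r) s)}.
  by apply: within_continuousZD; [exact: within_continuousBZ |
    exact: runinf_continuous].
have rc : {within `[0, T], continuous (fun s => c * x s + runinf h s)}.
  by apply: within_continuousZD => //; exact: runinf_continuous.
have [t0 tT'] := andP tT.
have [u ut [Iu xu]] := runinf_min xc tT.
have key r s : 0 <= r -> r <= s -> s <= t ->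
    (exists2 s', r <= s' <= t & x s' - runinf x t <=
      x s - 2 * runinf x s + runinf x r).
  move=> r0 rs st.
  (* If u <= r, then [runinf x] is constant on [r, t] and s itself serves. Otherwise u makes the
     left side 0, while the right side is nonnegative. *)
  have [ur|ru] := leP u r.
    have := @runinf_le _ T x u r xc ltac:(lra) ltac:(lra).
    have := @runinf_anti _ T x r s xc ltac:(lra) ltac:(lra).
    have := @runinf_anti _ T x s t xc ltac:(lra) ltac:(lra).
    by exists s; lra.
  exists u; first by lra.
  have := @runinf_le _ T x s s xc ltac:(lra) ltac:(lra).
  have := @runinf_anti _ T x r s xc ltac:(lra) ltac:(lra); lra.
(* Where [runinf x] drops, its minimum points make the bracket vanish in the
   limit; they are found by the intermediate value theorem. *)
have key' r s e : 0 <= r -> r <= s -> s <= t -> 0 < e ->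
    (exists2 s', r <= s' <= t & x s' - 2 * runinf x s' + runinf x r <=
      x s - runinf x t + e).
  move=> r0 rs st e0.
  have [I_eq|I_lt] := leP (runinf x r) (runinf x t).
    have := @runinf_anti _ T x r s xc ltac:(lra) ltac:(lra).
    have := @runinf_anti _ T x s t xc ltac:(lra) ltac:(lra).
    by exists s; lra.
  (* Capping [d] keeps the level [runinf x r - d] within the range of [runinf x] on [r, t]. A
     minimum point v at that level lies after r, since [x v < runinf x r], and brings the left side
     down to at most [d]. *)
  pose d := Num.min e (runinf x r - runinf x t).
  have d0 : 0 < d by rewrite lt_min e0 /=; lra.
  have de : d <= e by rewrite ge_min lexx.
  have dI : d <= runinf x r - runinf x t by rewrite ge_min lexx orbT.
  have rt : r <= t by lra.
  have Irt : {within `[r, t], continuous (runinf x)}.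
    by apply: continuous_subspaceW Ic; apply: subset_itv; rewrite bnd_simp.
  have [|w] := @IVT _ (runinf x) r t (runinf x r - d) rt Irt.
    by rewrite ge_min le_max; apply/andP; split; apply/orP; [right|left]; lra.
  rewrite in_itv /= => wrt Iw.
  have [v vw [Iv xv]] := @runinf_min _ T x w xc ltac:(lra).
  have rv : r < v.
    rewrite ltNge; apply/negP => vr.
    have := @runinf_le _ T x v r xc ltac:(lra) ltac:(lra); lra.
  exists v; first by lra.
  have := @runinf_anti _ T x v w xc ltac:(lra) ltac:(lra).
  have := @runinf_le _ T x s t xc ltac:(lra) ltac:(lra); lra.
apply/eqP; rewrite eq_le; apply/andP; split.
  rewrite -lerBlDl; apply/(le_runinf _ rc tT) => s st.
  have sT : 0 <= s <= T by lra.
  rewrite -lerBlDl; apply/(le_runinf _ hc sT) => r rs.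
  apply/ler_addgt0Pr => e e0; rewrite lerBlDl.
  have c1 : 0 < c + 1 by lra.
  (* The denominator [c + 1] also covers c = 0. *)
  pose d := e / (c + 1); have d0 : 0 < d by rewrite divr_gt0.
  have cd : c * d <= e.
    by rewrite mulrCA ler_piMr ?(ltW e0)// ler_pdivrMr //; lra.
  have [s' s't] := @key' r s d ltac:(lra) ltac:(lra) ltac:(lra) d0.
  move/(ler_wpM2l c0).
  have := @runinf_le _ T _ s' t lc ltac:(lra) ltac:(lra).
  have := @runinf_le _ T _ r s' hIc ltac:(lra) ltac:(lra).
  rewrite /=; move: cd; clear; lra.
apply/(le_runinf _ lc tT) => s st.
have sT : 0 <= s <= T by lra.
rewrite -lerBlDl; apply/(le_runinf _ hIc sT) => r rs.
have [s' s't /(ler_wpM2l c0)] := @key r s ltac:(lra) ltac:(lra) ltac:(lra).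
have := @runinf_le _ T _ s' t rc ltac:(lra) ltac:(lra).
have := @runinf_le _ T _ r s' hc ltac:(lra) ltac:(lra).
rewrite /=; clear; lra.
Qed.

(** * Nested infima and their change under a Pitman transform *)

(* The infimum over t >= s_0 >= ... >= s_(k-1) >= 0 of
   U_i x(s_0) + U_(i+1) y(s_1) + U_(i+2) x(s_2) + ..., with k terms *)
Fixpoint chain (R : realType) (U : nat -> R) (k i : nat) (x y : R -> R) :
    R -> R :=
  if k is k'.+1 then runinf (fun s => U i * x s + chain U k' i.+1 y x s)
  else fun=> 0.

Lemma chain_continuous (R : realType) (T : R) (U : nat -> R) (k i : nat)
    (x y : R -> R) :
  {within `[0, T], continuous x} -> {within `[0, T], continuous y} ->
  {within `[0, T], continuous (chain U k i x y)}.
Proof.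
elim: k i x y => [|k IH] i x y xc yc /=; first by move=> t; exact: cvg_cst.
by apply/runinf_continuous/within_continuousZD => //; exact: IH.
Qed.

(** The innermost of the [k.+1] terms has the coefficient [U (i + k)]. *)
Lemma chain_last (R : realType) (T : R) (U : nat -> R) (k i : nat)
    (x y : R -> R) (t : R) :
  U (i + k)%N = 0 -> 0 <= t <= T -> chain U k.+1 i x y t = chain U k i x y t.
Proof.
elim: k i x y t => [|k IH] i x y t Uik tT.
  have zc : {within `[0, T], continuous (fun=> 0 : R)}.
    by move=> s; exact: cvg_cst.
  rewrite addn0 in Uik; rewrite /= Uik.
  rewrite (@eq_runinf _ _ (fun=> 0)); last by move=> s _; rewrite mul0r addr0.
  by have [u _ [-> _]] := runinf_min zc tT.
apply: eq_runinf => s st; congr (_ + _).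
by apply: IH; [rewrite addSnnS | lra].
Qed.

(** Induction by two terms: the inner chain yields [- U i.+2 * runinf x], which together with
    [U i.+1 * rho * runinf x] leaves [U i * runinf x] by the recurrence, as [runinf_exchange]
    requires. For l = 0 the two terms on the right cancel. *)
Lemma chain_even (R : realType) (T rho : R) (U : nat -> R) (l i : nat)
    (x y : R -> R) (t : R) :
  (forall j, U j.+2 = rho * U j.+1 - U j) ->
  (forall j, (j <= i + l.*2)%N -> 0 <= U j) ->
  {within `[0, T], continuous x} -> {within `[0, T], continuous y} ->
  0 <= t <= T ->
  chain U l.*2 i (fun s => x s - 2 * runinf x s)
    (fun s => y s + rho * runinf x s) t =
  - U i * runinf x t + chain U l.*2.+1 i x y t.
Proof.
move=> Urec + xc yc; elim: l i t => [|l IH] i t Uge0 tT.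
  rewrite /= [X in _ + X](@eq_runinf _ _ (fun s => U i * x s)) => [|s _];
    last exact: addr0.
  by rewrite (runinf_scale xc) ?Uge0 ?addn0//; ring.
have Uik : (i.+2 + l.*2 = i + l.+1.*2)%N by rewrite doubleS !addnS.
have hc := within_continuousZD (c := U i.+1) yc
  (chain_continuous (U := U) (k := l.*2.+1) (i := i.+2) xc yc).
rewrite doubleS -[RHS](runinf_exchange xc hc) ?Uge0 ?leq_addr//.
apply: eq_runinf => s st; congr (_ + _); apply: eq_runinf => r rs.
rewrite [X in _ + X = _]IH.
- by rewrite /= Urec; ring.
- by move=> j; rewrite Uik; exact: Uge0.
- lra.
Qed.

(** Behind the first term stands an even chain of index 1; its [- U 1 * runinf x] cancels the
    [rho * runinf x] of the first term. *)
Lemma chain_odd (R : realType) (T rho : R) (U : nat -> R) (l : nat)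
    (x y : R -> R) (t : R) :
  U 0%N = 1 -> U 1%N = rho -> (forall j, U j.+2 = rho * U j.+1 - U j) ->
  (forall j, (j <= l.*2.+1)%N -> 0 <= U j) ->
  {within `[0, T], continuous x} -> {within `[0, T], continuous y} ->
  0 <= t <= T ->
  chain U l.*2.+1 0 (fun s => y s + rho * runinf x s)
    (fun s => x s - 2 * runinf x s) t =
  chain U l.*2.+2 0 y x t.
Proof.
move=> U0 <- Urec Uge0 xc yc tT; apply: eq_runinf => s st.
have sT : 0 <= s <= T by lra.
by rewrite [X in _ + X = _](@chain_even _ T)// U0 /= -/(chain U l.*2); ring.
Qed.

(** * Alternating products of Pitman transforms *)

(** [alt_comp] recurses on the outermost factor, the induction below on the innermost. *)
Lemma alt_comp_innermost (X : Type) (k : nat) (f g : X -> X) :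
  alt_comp k.+1 f g = alt_comp k f g \o (if odd k then g else f).
Proof.
elim: k f g => [|k IH] f g //.
by rewrite [LHS]/= -/(alt_comp k.+1 g f) IH /=; case: (odd k).
Qed.

(** For k > 0 the chain of even length starts with the form of the new innermost root: [chain_even]
    lengthens it and frees a running infimum that cancels the one subtracted by the new factor.
    [chain_odd] lengthens the other chain. *)
Lemma alt_comp_pitman (R : realType) (V : topologicalLmodType R) (T rho : R)
    (U : nat -> R) (k : nat) (a b : V) (av bv : {scalar V}) (p : R -> V)
    (t : R) :
  U 0%N = 1 -> U 1%N = rho -> (forall j, U j.+2 = rho * U j.+1 - U j) ->
  (forall j, (j < k)%N -> 0 <= U j) ->
  av a = 2 -> bv b = 2 -> av b = - rho -> bv a = - rho ->
  {within `[0, T], continuous (av \o p)} ->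
  {within `[0, T], continuous (bv \o p)} ->
  0 <= t <= T ->
  alt_comp k (pitman a av) (pitman b bv) p t =
  p t - chain U k 0 (av \o p) (bv \o p) t *: a
      - chain U k.-1 0 (bv \o p) (av \o p) t *: b.
Proof.
move=> U0 U1 Urec.
elim: k a b av bv p t => [|k IH] a b av bv p t Uge0 ava bvb avb bva xc yc tT.
  by rewrite /= !scale0r !subr0.
have pitmanE (c : V) (cv : {scalar V}) (q : R -> V) :
  pitman c cv q = fun s => q s - runinf (cv \o q) s *: c by [].
have self (c : V) (cv : {scalar V}) : cv c = 2 ->
    cv \o pitman c cv p = fun s => cv (p s) - 2 * runinf (cv \o p) s.
  by move=> cvc; apply/funext => s /=; rewrite linearB linearZ /= cvc mulrC.
have other (c : V) (cv dv : {scalar V}) : dv c = - rho ->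
    dv \o pitman c cv p = fun s => dv (p s) + rho * runinf (cv \o p) s.
  by move=> dvc; apply/funext => s /=; rewrite linearB linearZ /= dvc; ring.
have Uge0' j : (j < k)%N -> 0 <= U j by move/ltnW/Uge0.
rewrite alt_comp_innermost; case: ifPn => [k_odd|k_even]; rewrite [LHS]/=.
  have [l kE] : exists l, k = l.*2.+1.
    by exists k./2; rewrite -[LHS]odd_double_half k_odd.
  have IHb := IH a b av bv (pitman b bv p) t Uge0' ava bvb avb bva.
  rewrite self// other// in IHb; rewrite IHb//; last 2 first.
  - exact: within_continuousDZ (runinf_continuous yc).
  - exact: within_continuousBZ (runinf_continuous yc).
  rewrite {}kE in Uge0 *; rewrite [l.*2.+1.-1]/= [l.*2.+2.-1]/=.
  rewrite (chain_odd U0 U1 Urec _ yc xc tT)//.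
  rewrite (chain_even Urec _ yc xc tT) => [|j]; last first.
    by rewrite add0n => jl; apply: Uge0; rewrite !ltnS leqW.
  rewrite U0 mulN1r scalerDl pitmanE.
  have cancelb (u v w : V) (r : R) :
      u - r *: b - v - (- r *: b + w) = u - v - w.
    rewrite scaleNr opprD opprK addrA; congr (_ - w).
    by rewrite addrAC subrK.
  exact: cancelb.
have IHa := IH a b av bv (pitman a av p) t Uge0' ava bvb avb bva.
rewrite self// other// in IHa; rewrite IHa//; last 2 first.
- exact: within_continuousBZ (runinf_continuous xc).
- exact: within_continuousDZ (runinf_continuous xc).
(* k = 0 stands apart because [0.-1] is 0: both chains are empty and only the one at [a] gains a
   term. *)
case: k k_even Uge0 {IH IHa Uge0'} => [_ _|k k_odd Uge0].
  rewrite [LHS]/= !scale0r !subr0 pitmanE /=.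
  by congr (_ - _ *: _); apply: eq_runinf => s _; rewrite U0 mul1r addr0.
have [l kE] : exists l, k = l.*2.+1.
  exists k./2; rewrite -[LHS]odd_double_half.
  by move: k_odd => /=; rewrite negbK => ->.
rewrite {}kE in Uge0 *; rewrite [l.*2.+2.-1]/= [l.*2.+3.-1]/= -doubleS.
rewrite (chain_odd U0 U1 Urec _ xc yc tT) => [|j jl]; last first.
  by apply: Uge0; rewrite !ltnS leqW.
rewrite (chain_even Urec _ xc yc tT) => [|j]; last first.
  by rewrite add0n doubleS => jl; apply: Uge0; rewrite !ltnS.
rewrite U0 mulN1r scalerDl pitmanE.
have cancela (u v w : V) (r : R) :
    u - r *: a - (- r *: a + v) - w = u - v - w.
  by rewrite scaleNr opprD opprK addrA subrK.
exact: cancela.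
Qed.

Lemma alt_comp_pitman_sym (R : realType) (V : topologicalLmodType R) (T rho : R)
    (U : nat -> R) (n : nat) (a b : V) (av bv : {scalar V}) (p : R -> V)
    (t : R) :
  U 0%N = 1 -> U 1%N = rho -> (forall j, U j.+2 = rho * U j.+1 - U j) ->
  (forall j, (j < n.+1)%N -> 0 <= U j) -> U n = 0 ->
  av a = 2 -> bv b = 2 -> av b = - rho -> bv a = - rho ->
  {within `[0, T], continuous (av \o p)} ->
  {within `[0, T], continuous (bv \o p)} ->
  0 <= t <= T ->
  alt_comp n.+1 (pitman a av) (pitman b bv) p t =
  alt_comp n.+1 (pitman b bv) (pitman a av) p t.
Proof.
move=> U0 U1 Urec Uge0 Un ava bvb avb bva xc yc tT.
rewrite !(alt_comp_pitman U0 U1 Urec Uge0 _ _ _ _ _ _ tT)//.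
by rewrite !(@chain_last _ T)// [LHS]addrAC.
Qed.

(** * Rescaling of a root and the braid relation *)

(** One inequality, used for c and then for its inverse, gives equality; without an infimum both
    sides take the default value 0. *)
Lemma inf_scale (R : realType) (c : R) (E : set R) :
  0 < c -> inf [set c * x | x in E] = c * inf E.
Proof.
move=> c0.
have [->|E0] := eqVneq E set0; first by rewrite image_set0 inf0 mulr0.
have scale_le (d : R) (F : set R) : 0 < d -> has_inf F ->
    has_inf [set d * x | x in F] /\ d * inf F <= inf [set d * x | x in F].
  move=> d0 [[x Fx] Flb].
  have lb : lbound [set d * x | x in F] (d * inf F).
    by move=> _ [y Fy <-]; rewrite ler_pM2l// ge_inf.
  split; first by split; [exists (d * x), x | exists (d * inf F)].
  by apply: lb_le_inf lb; exists (d * x), x.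
have cK : [set c^-1 * y | y in [set c * x | x in E]] = E.
  rewrite image_comp -[RHS]image_id; apply: eq_imagel => x _ /=.
  by rewrite mulKf ?gt_eqF.
have ci0 : 0 < c^-1 by rewrite invr_gt0.
have [Einf|nEinf] := pselect (has_inf E).
  have [cEinf le1] := scale_le c E c0 Einf.
  have [_] := scale_le _ _ ci0 cEinf.
  rewrite cK mulrC ler_pdivrMr// mulrC => le2.
  by apply/eqP; rewrite eq_le le2.
rewrite !inf_out ?mulr0// => cEinf; apply: nEinf.
by rewrite -cK; apply: (scale_le _ _ ci0 cEinf).1.
Qed.

Lemma pitman_scale (R : realType) (V : topologicalLmodType R) (c : R) (a : V)
    (av : {scalar V}) :
  0 < c -> pitman (c *: a) (c^-1 \*: av) = pitman a av.
Proof.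
move=> c0; apply/funext => p; apply/funext => t; rewrite /pitman.
have -> : [set (c^-1 \*: av) (p s) | s in `[0, t]] =
    [set c^-1 * x | x in [set av (p s) | s in `[0, t]]].
  by rewrite image_comp.
by rewrite inf_scale ?invr_gt0// scalerA mulrAC mulVf ?gt_eqF// mul1r.
Qed.

Theorem theorem2p4 (R : realType) (V : topologicalLmodType R)
    (a b : V) (av bv : {scalar V})
    (av_cont : continuous av) (bv_cont : continuous bv)
    (ava : av a = 2) (bvb : bv b = 2)
    (avb : av b < 0) (bva : bv a < 0)
    (n : nat) (n_ge2 : (2 <= n)%N)
    (avbva : av b * bv a = 4 * cos (pi / n%:R) ^+ 2)
    (T : R) (p : R -> V) (p_path : is_path T p)
    (t : R) (t0T : 0 <= t <= T) :
  alt_comp n (pitman a av) (pitman b bv) p t =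
  alt_comp n (pitman b bv) (pitman a av) p t.
Proof.
have n_gt0 : 0 < n%:R :> R by rewrite ltr0n (leq_trans _ n_ge2).
pose th : R := pi / n%:R.
have th_gt0 : 0 < th by rewrite divr_gt0 ?pi_gt0.
have th_le : th <= pi / 2.
  by rewrite ler_pM2l ?pi_gt0// lef_pV2 ?posrE// ?ltr0n// ler_nat.
have nth : n%:R * th = pi by rewrite mulrC divfK ?gt_eqF.
have sin_gt0 : 0 < sin th.
  by rewrite sin_gt0_pi// th_gt0/=; move: (pi_gt0 R); lra.
have cos_ge0 : 0 <= cos th by rewrite cos_ge0_pihalf//; move: (pi_gt0 R); lra.
(* Chebyshev polynomials of the second kind at [cos th]. As n th = pi, they are nonnegative for j <
   n and vanish for j = n - 1. *)
pose U j := sin (j.+1%:R * th) / sin th.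
have U0 : U 0%N = 1 by rewrite /U mul1r divff ?gt_eqF.
have U1 : U 1%N = 2 * cos th.
  by rewrite /U mulr_natl mulr2n sinD; field; rewrite gt_eqF.
have Urec j : U j.+2 = 2 * cos th * U j.+1 - U j.
  rewrite /U; have -> : j.+3%:R * th = j.+2%:R * th + th.
    by rewrite -[in LHS]addn1 natrD mulrDl mul1r.
  have -> : j.+1%:R * th = j.+2%:R * th - th.
    by rewrite -[in RHS]addn1 natrD mulrDl mul1r addrK.
  by rewrite sinD sinB; field; rewrite gt_eqF.
have Uge0 j : (j < n.-1.+1)%N -> 0 <= U j.
  move=> jn; rewrite divr_ge0 ?(ltW sin_gt0)// sin_ge0_pi//.
  rewrite mulr_ge0 ?(ltW th_gt0)//=.
  by rewrite -nth ler_pM2r// ler_nat -(prednK (ltnW n_ge2)).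
have Un : U n.-1 = 0 by rewrite /U prednK ?(ltnW n_ge2)// nth sinpi mul0r.
(* Replacing (a, av) by (c a, av / c) does not change its Pitman transform;
   this choice of c makes the two off-diagonal pairings equal. *)
pose c := Num.sqrt (av b / bv a).
have ratio_gt0 : 0 < av b / bv a by rewrite nmulr_rgt0 ?invr_lt0.
have c_gt0 : 0 < c by rewrite sqrtr_gt0.
have c2 : c ^+ 2 = av b / bv a by rewrite sqr_sqrtr ?ltW.
have avbE : av b = c ^+ 2 * bv a by rewrite c2 divfK ?lt_eqF.
(* The squares agree by [avbva]. The sign is settled by [bv a < 0] and by [cos th >= 0], which comes
   from n >= 2. *)
have bvaE : c * bv a = - (2 * cos th).
  apply: oppr_inj; rewrite opprK; apply/eqP.
  rewrite -(@eqrXn2 _ 2)//; last 2 first.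
  - by rewrite oppr_ge0 pmulr_rle0// ltW.
  - by rewrite mulr_ge0.
  by apply/eqP; rewrite exprMn -[2 ^+ 2]natrX -avbva avbE; ring.
have [pc _] := p_path.
rewrite -(pitman_scale a av c_gt0) -(prednK (ltnW n_ge2)).
apply: (alt_comp_pitman_sym U0 U1 Urec Uge0 Un _ _ _ _ _ _ t0T) => //=.
- by rewrite linearZ /= ava scalerA mulVf ?gt_eqF// scale1r.
- by rewrite avbE -bvaE scalerA exprS mulKf ?gt_eqF.
- by rewrite linearZ.
- move=> x; apply: cvgM; first exact: cvg_cst.
  by apply: (@within_continuous_comp _ _ _ _ p av) => // ? _; exact: av_cont.
- by apply: within_continuous_comp => // ? _; exact: bv_cont.
Qed.
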